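(* Let $d\ge 3$ be an integer and let $s=\binom{d}{2}+1$. If $\mathbb{X}\in\chi(H_{gen,s})$, then $H_{2\mathbb{X}}(t)=\binom{t+2}{2}$ for all integers $0\le t\le d$.
   Context: Let $k$ be an algebraically closed field of characteristic $0$, $R=k[x,y,z]$ with the standard grading, and $\mathbb{P}^2=\mathbb{P}^2_k$. For a homogeneous ideal $I\subset R$, the Hilbert function of $R/I$ is $H_{R/I}(t)=\dim_k R_t-\dim_k I_t$ for $t\in\mathbb{N}=\{0,1,2,\dots\}$. For a finite set $\mathbb{X}=\{P_1,\dots,P_s\}$ of $s$ distinct points of $\mathbb{P}^2$, let $\wp_i\subset R$ be the homogeneous prime ideal of $P_i$. Put $I_{\mathbb{X}}=\wp_1\cap\cdots\cap\wp_s$ and $H_{\mathbb{X}}=H_{R/I_{\mathbb{X}}}$. The double point scheme $2\mathbb{X}$ supported on $\mathbb{X}$ is the scheme defined by $I_{2\mathbb{X}}=\wp_1^2\cap\cdots\cap\wp_s^2$, and $H_{2\mathbb{X}}=H_{R/I_{2\mathbb{X}}}$. The generic Hilbert function of $s$ points is $H_{gen,s}(t)=\min\{s,\binom{t+2}{2}\}$, and $\chi(H_{gen,s})$ is the set of all sets $\mathbb{X}$ of $s$ distinct points of $\mathbb{P}^2$ with $H_{\mathbb{X}}=H_{gen,s}$. *)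

(* Defs.v *)
From HB Require Import structures.
From mathcomp Require Import all_boot all_order all_algebra.
From mathcomp Require Import finmap boolp classical_sets.
From mathcomp Require Import mpoly.

Set Implicit Arguments.
Unset Strict Implicit.
Unset Printing Implicit Defensive.

Import GRing.Theory.

Local Open Scope classical_set_scope.
Local Open Scope ring_scope.

(* A point of the projective plane is a line through the origin of k^3. *)
Record P2 (k : fieldType) : Type := MkP2 {
  P2_line :> {vspace 'rV[k]_3};
  _ : \dim P2_line == 1%N }.

HB.instance Definition _ (k : fieldType) := [isSub for @P2_line k].
HB.instance Definition _ (k : fieldType) := [Choice of P2 k by <:].

Definition hom_coords (k : fieldType) (P : P2 k) : set 'rV[k]_3 :=
  [set v | v \in (P : {vspace _}) /\ v != 0].

Definition ideal_gen (A : comNzRingType) (S : set A) : set A :=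
  [set f | exists (m : nat) (a g : 'I_m -> A),
     (forall i, S (g i)) /\ f = \sum_(i < m) a i * g i].

Definition ideal_mul (A : comNzRingType) (I J : set A) : set A :=
  ideal_gen [set f * g | f in I & g in J].

(* Vanishing of a homogeneous f at P does not depend on the chosen homogeneous
   coordinates v of P, so quantifying over all of them is harmless. *)
Definition point_ideal (k : fieldType) (P : P2 k) : set {mpoly k[3]} :=
  ideal_gen [set f : {mpoly k[3]} | (exists e : nat, f \is e.-homog) /\
                (forall v, hom_coords P v -> f.@[v ord0] = 0)].

Definition ideal_pts (k : fieldType) (X : {fset P2 k}) : set {mpoly k[3]} :=
  \bigcap_(P in [set P | P \in X]) point_ideal P.

Definition ideal_double_pts (k : fieldType) (X : {fset P2 k}) :
    set {mpoly k[3]} :=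
  \bigcap_(P in [set P | P \in X]) ideal_mul (point_ideal P) (point_ideal P).

(* The largest size of a linearly independent family in S: the dimension of S
   whenever S is a linear subspace (see setdim_vspace). *)
Definition setdim (k : fieldType) (V : vectType k) (S : set V) : nat :=
  \max_(m < (\dim {:V}).+1 |
      `[< exists b : m.-tuple V, free b /\ forall v, v \in b -> S v >]) m.

Lemma setdim_vspace (k : fieldType) (V : vectType k) (U : {vspace V}) :
  setdim [set v | v \in U] = \dim U.
Proof.
apply/eqP; rewrite eqn_leq; apply/andP; split.
  apply/bigmax_leqP => m /asboolP [b [fb bU]].
  have <- : \dim <<b>> = m by rewrite (eqnP fb) size_tuple.
  by apply: dimvS; apply/span_subvP.
have lt_U : (\dim U < (\dim {:V}).+1)%N by rewrite ltnS dimvS ?subvf.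
apply: (@leq_bigmax_cond _ _ (fun m : 'I_(\dim {:V}).+1 => m : nat)
          (Ordinal lt_U)).
apply/asboolP; exists (vbasis U); split; first exact: basis_free (vbasisP U).
by move=> v; apply: vbasis_mem.
Qed.

(* [dhomog 3 k t] is the graded piece R_t of R = k[x,y,z]. *)
Definition hilbert (k : fieldType) (I : set {mpoly k[3]}) (t : nat) : nat :=
  (\dim {: dhomog 3 k t}
   - setdim [set f : dhomog 3 k t | I (mpoly_of_dhomog f)])%N.

Definition H_pts (k : fieldType) (X : {fset P2 k}) : nat -> nat :=
  hilbert (ideal_pts X).

Definition H_double_pts (k : fieldType) (X : {fset P2 k}) : nat -> nat :=
  hilbert (ideal_double_pts X).

Definition H_gen (s t : nat) : nat := minn s 'C(t + 2, 2).

Definition chi_gen (k : fieldType) (s : nat) : set {fset P2 k} :=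
  [set X | #|` X| = s /\ forall t : nat, H_pts X t = H_gen s t].

(* Main.v *)
Require Import Defs.
From HB Require Import structures.
From mathcomp Require Import all_boot all_order all_algebra.
From mathcomp Require Import finmap boolp classical_sets.
From mathcomp Require Import zify ring.
From mathcomp Require Import mpoly.

(** Let [F] be a nonzero form singular at all points of [X]; multiplying by a
    power of a variable, its degree may be taken to be [d]. The number of
    points is such that [2s = d(d-1) + 2].

    First, [F] has a multiple factor. Geometrically, [F] and its derivative
    [D_a F] in a general direction [a] meet with multiplicity at least two at
    each point of [X], and [2s > d(d-1)], so by Bezout they share a component.
    Instead of Bezout's theorem the proof counts dimensions
    ([nontrivial_syzygy]). Consider [(A, B) |-> A F - B D_a F], from pairs of
    forms of degrees [d-1] and [d] to forms of degree [2d-1]. Each point of [X]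
    imposes two linear conditions on the image. All these conditions are
    independent: since [H_X(d-1) = s], there are forms of degree [d-1] that
    separate one point from the others, and their squares, multiplied by linear
    forms, separate first-order jets ([jet_separator]). Hence the kernel has
    dimension at least three, and contains a pair which is not a multiple of
    [(D_a F, F)]. If [F] were squarefree, unique factorization would show that
    [F] divides [B] ([squarefree_syzygy]), and the pair would be such a multiple
    ([repeated_factor]).

    Second, write [F = p^2 q]. At a point of [X] where [p] does not vanish, [q]
    is singular; hence [p * dq/dx_i] vanishes on [X]. It has degree at most
    [d-2], and it is nonzero for some [i] unless [q] is constant, in which case
    [p] itself vanishes on [X] and has degree [d/2 <= d-2]
    ([double_factor_divisor]). This contradicts [H_X(d-2) = C(d, 2)], by which
    no nonzero form of degree [d-2] vanishes on [X].

    Unique factorization in [k[x,y,z]] comes from Gauss's lemma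
    ([poly_irreducibles_prime]), by induction on the number of variables. *)

Set Implicit Arguments.
Unset Strict Implicit.
Unset Printing Implicit Defensive.

Import GRing.Theory.
Local Open Scope ring_scope.

(** * Divisibility and Gauss's lemma *)

Section Divisibility.
Variable R : idomainType.
Implicit Types a b c p u : R.

Definition divides a b := exists c, b = a * c.

Definition irreducible p :=
  [/\ p != 0, p \isn't a GRing.unit &
      forall a b, p = a * b -> a \is a GRing.unit \/ b \is a GRing.unit].

(** Euclid's property alone, to be combined with [irreducible]. *)
Definition prime_like p :=
  forall a b, divides p (a * b) -> divides p a \/ divides p b.

Lemma divides_mulr p a b : divides p a -> divides p (a * b).
Proof. by case=> c ->; exists (c * b); rewrite mulrA. Qed.

Lemma divides_mull p a b : divides p b -> divides p (a * b).
Proof. by rewrite mulrC; apply: divides_mulr. Qed.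

Lemma divides_add p a b : divides p a -> divides p b -> divides p (a + b).
Proof. by case=> c -> [e ->]; exists (c + e); rewrite mulrDr. Qed.

Lemma divides_addl p a b : divides p a -> divides p (a + b) -> divides p b.
Proof.
case=> c -> [e he]; exists (e - c).
by rewrite mulrBr -he addrC addKr.
Qed.

Lemma divides0 p : divides p 0.
Proof. by exists 0; rewrite mulr0. Qed.

Lemma divides_sum (I : Type) (r : seq I) (P : pred I) (F : I -> R) p :
  (forall i, P i -> divides p (F i)) -> divides p (\sum_(i <- r | P i) F i).
Proof.
move=> h; elim/big_rec: _ => [|i x Pi dx]; first exact: divides0.
exact: divides_add (h i Pi) dx.
Qed.

End Divisibility.

(** The two halves of unique factorization are kept apart: existence of
    factorizations is a matter of degrees, and only the second half has to be
    carried from [R] to [{poly R}]. *)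
Definition atomic (R : idomainType) := forall a : R, a != 0 ->
  exists u s, [/\ u \is a GRing.unit, forall p, p \in s -> irreducible p &
                  a = u * \prod_(p <- s) p].

Definition irreducibles_prime (R : idomainType) :=
  forall p : R, irreducible p -> prime_like p.

Section Gauss.
Variable R : idomainType.
Implicit Types f g h : {poly R}.

Lemma divides_polyC (p : R) f :
  (forall i, divides p f`_i) -> divides p%:P f.
Proof.
move=> /choice[q hq]; exists (\poly_(i < size f) q i).
apply/polyP=> i; rewrite coefCM coef_poly; case: ltnP => [_|hi]; first exact: hq.
by rewrite mulr0 nth_default.
Qed.

Lemma coef_divides_polyC (p : R) f i : divides p%:P f -> divides p f`_i.
Proof. by case=> q ->; exists q`_i; rewrite coefCM. Qed.

(** If [p] divides neither [f] nor [g], take in each the first coefficient that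
    is not a multiple of [p]: in the coefficient of [f * g] at the sum of their
    indices, all terms but their product are multiples of [p]. *)
Lemma prime_like_polyC (p : R) : prime_like p -> prime_like p%:P.
Proof.
move=> pp f g dfg.
have [df|ndf] := pselect (forall i, divides p f`_i).
  by left; apply: divides_polyC.
have [dg|ndg] := pselect (forall i, divides p g`_i).
  by right; apply: divides_polyC.
exfalso.
have first_bad h : ~ (forall i, divides p h`_i) ->
    exists i, ~ divides p h`_i /\ forall j, (j < i)%N -> divides p h`_j.
  move=> /existsNP[i0 hi0].
  have ex : exists i, `[< ~ divides p h`_i >] by exists i0; apply/asboolP.
  case: (ex_minnP ex) => i /asboolP hi mini; exists i; split=> // j ltji.
  apply: contrapT => hj.
  by have := mini j; rewrite leqNgt ltji => /(_ (introT (asboolP _) hj)).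
have [i [hi mini]] := first_bad f ndf.
have [j [hj minj]] := first_bad g ndg.
have := coef_divides_polyC (i + j) dfg.
rewrite coefM.
have lti : (i < (i + j).+1)%N by rewrite ltnS leq_addr.
rewrite (bigD1 (Ordinal lti)) //= addrC => dsum.
have : divides p (f`_i * g`_(i + j - i)).
  apply: divides_addl dsum.
  apply: divides_sum => l ne_li.
  have [ltli|leil] := ltnP l i; first exact/divides_mulr/mini.
  apply/divides_mull/minj.
  have {ne_li}ltil : (i < l)%N.
    by rewrite ltn_neqAle leil andbT eq_sym; move: ne_li; rewrite -val_eqE.
  by rewrite ltn_subLR ?ltn_add2r // -ltnS.
by rewrite addKn => /pp[/hi|/hj].
Qed.

Hypothesis R_atomic : atomic R.
Hypothesis R_prime : irreducibles_prime R.

Lemma size_mulC (p : R) f : p != 0 -> size (p%:P * f) = size f.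
Proof. by move=> p0; rewrite mul_polyC size_scale. Qed.

(** A factorization over the fraction field of [R] descends to [R]: each prime
    factor of the denominator [c] divides one of the two factors, and can be
    cancelled there without changing any degree. *)
Lemma factor_clear_denominator (c : R) f g h :
    c != 0 -> c%:P * f = g * h ->
  exists g' h', [/\ f = g' * h', size g' = size g & size h' = size h].
Proof.
move=> c0; have [u [s [uu irrs ->]]] := R_atomic c0.
elim: s irrs f g h => [|p s IH] irrs f g h.
  rewrite big_nil mulr1 => e; exists (u^-1%:P * g), h.
  split=> //; last first.
    rewrite size_mulC // invr_eq0.
    by apply: contraTneq uu => ->; rewrite unitr0.
  by rewrite -mulrA -e mulrA -polyCM mulVr // mul1r.
have irrs' q : q \in s -> irreducible q.
  by move=> qs; apply: irrs; rewrite inE qs orbT.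
have irrp := irrs p (mem_head p s); have [p0 _ _] := irrp.
have p0P : p%:P != 0 by rewrite polyC_eq0.
rewrite big_cons mulrCA polyCM -mulrA => e.
have := prime_like_polyC (R_prime irrp) (a := g) (b := h); case.
- by rewrite -e; exists ((u * \prod_(q <- s) q)%:P * f).
- case=> g1 eg; move: e; rewrite eg -mulrA => e1.
  have {e1}e := mulfI p0P e1.
  have [g' [h' [ef sg sh]]] := IH irrs' f g1 h e.
  by exists g', h'; rewrite size_mulC.
- case=> h1 eh; move: e; rewrite eh [g * _]mulrCA => e1.
  have {e1}e := mulfI p0P e1.
  have [g' [h' [ef sg sh]]] := IH irrs' f g h1 e.
  by exists g', h'; rewrite size_mulC.
Qed.

Lemma primitive_divides (c : R) f g :
    (forall p : R, irreducible p -> ~ divides p%:P f) ->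
    c != 0 -> divides f (c%:P * g) -> divides f g.
Proof.
move=> primf c0; have [u [s [uu irrs ->]]] := R_atomic c0.
elim: s irrs g => [|p s IH] irrs g.
  rewrite big_nil mulr1 => -[w ew]; exists (u^-1%:P * w).
  by rewrite mulrCA -ew mulrA -polyCM mulVr // mul1r.
have irrs' q : q \in s -> irreducible q.
  by move=> qs; apply: irrs; rewrite inE qs orbT.
have irrp := irrs p (mem_head p s); have [p0 _ _] := irrp.
have p0P : p%:P != 0 by rewrite polyC_eq0.
rewrite big_cons mulrCA polyCM -mulrA => -[w ew].
have := prime_like_polyC (R_prime irrp) (a := f) (b := w); case.
- by rewrite -ew; exists ((u * \prod_(q <- s) q)%:P * g).
- by move/(primf _ irrp).
- case=> w1 ew1; move: ew; rewrite ew1 [f * _]mulrCA => e1.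
  have {e1}e := mulfI p0P e1.
  by apply: (IH irrs'); exists w1.
Qed.

Lemma unit_polyC (p : R) : (p%:P \is a GRing.unit) = (p \is a GRing.unit).
Proof.
rewrite poly_unitE coefC /= size_polyC.
by have [->|p0] := eqVneq p 0; rewrite ?unitr0 ?p0.
Qed.

(** Gauss's lemma. The pseudo-gcd of an irreducible [f] and of [g] is a gcd over
    the fraction field; clearing denominators shows that it is either constant
    or of the degree of [f]. In the first case [f] divides the cofactor, in
    the second it divides [g], each time up to a denominator that a primitive
    [f] allows to cancel. *)
Lemma poly_irreducibles_prime : irreducibles_prime {poly R}.
Proof.
move=> f irrf; have [f0 nuf facf] := irrf.
have [/eqP/size_poly1P[p p0 ep]|sf] := eqVneq (size f) 1.
  rewrite ep; apply/prime_like_polyC/R_prime; split=> //.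
    by rewrite -unit_polyC -ep.
  by move=> a b eab; rewrite -!unit_polyC; apply: facf; rewrite ep eab polyCM.
have primf p : irreducible p -> ~ divides p%:P f.
  move=> [p0 nup _] [w ew].
  case: (facf _ _ ew); first by rewrite unit_polyC (negbTE nup).
  have : size w != 1 by rewrite -(@size_mulC p w p0) -ew.
  by rewrite poly_unitE => /negbTE ->.
have divf (g : {poly R}) : Pdiv.Idomain.dvdp f g -> divides f g.
  case/Pdiv.Idomain.dvdpP=> -[c q] /= c0 e.
  apply: (primitive_divides primf c0).
  by exists q; rewrite mul_polyC e mulrC.
move=> g h [w ew].
have [dfg|ndfg] := pselect (divides f g); first by left.
right; apply: divf; rewrite -(@Pdiv.Idomain.Gauss_dvdpr _ h g).
  rewrite ew; apply: Pdiv.Idomain.dvdp_mulIl.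
rewrite Pdiv.Idomain.coprimep_def; apply: contra_notT ndfg => se.
set e := Pdiv.Idomain.gcdp f g in se *.
have e0 : e != 0 by rewrite Pdiv.Idomain.gcdp_eq0 negb_and f0.
have /Pdiv.Idomain.dvdpP[[c q] /= c0 ef] : Pdiv.Idomain.dvdp e f.
  exact: Pdiv.Idomain.dvdp_gcdl.
have /Pdiv.Idomain.dvdpP[[c2 q2] /= c20 eg] : Pdiv.Idomain.dvdp e g.
  exact: Pdiv.Idomain.dvdp_gcdr.
have : c%:P * f = q * e by rewrite mul_polyC.
case/(factor_clear_denominator c0)=> q' [e' [ef' sq se']].
have /size_poly1P[q0 q00 eq0] : size q == 1.
  rewrite -sq; case: (facf _ _ ef'); first by rewrite poly_unitE => /andP[].
  by rewrite poly_unitE se' (negbTE se).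
have : q0 * c2 != 0 by rewrite mulf_neq0.
move/(primitive_divides primf); apply.
exists (c *: q2).
rewrite polyCM -mulrA [c2%:P * g]mul_polyC eg -scalerAr scalerAl ef eq0.
by rewrite [q2 * e]mulrC mulrA.
Qed.

End Gauss.

(** * Unique factorization in polynomial rings over a field *)

Section Transfer.
Variables (A B : idomainType).
Variables (phi : {rmorphism A -> B}) (psi : {rmorphism B -> A}).
Hypotheses (phiK : cancel phi psi) (psiK : cancel psi phi).

Lemma iso_unit a : (phi a \is a GRing.unit) = (a \is a GRing.unit).
Proof.
apply/idP/idP => [u|]; last exact: rmorph_unit.
by rewrite -(phiK a); apply: rmorph_unit.
Qed.

Lemma iso_irreducibles_prime : irreducibles_prime B -> irreducibles_prime A.
Proof.
move=> primeB p [p0 nup facp] a b [c e].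
have irrp : irreducible (phi p).
  split; [by rewrite -(rmorph0 phi) (can_eq phiK) | by rewrite iso_unit |].
  move=> x y exy; rewrite -[x]psiK -[y]psiK !iso_unit; apply: facp.
  by rewrite -rmorphM -exy phiK.
have back x : divides (phi p) (phi x) -> divides p x.
  by case=> y ey; exists (psi y); rewrite -[p]phiK -rmorphM -ey phiK.
have [] := primeB _ irrp (phi a) (phi b).
- by exists (phi c); rewrite -!rmorphM e.
- by move/back; left.
- by move/back; right.
Qed.

End Transfer.

Section Factorial.
Variable k : fieldType.

Lemma mpoly_unit_msize n (p : {mpoly k[n]}) :
  (p \is a GRing.unit) = (msize p == 1%N).
Proof.
apply/idP/idP => [/unitrP[q [qp _]]|/msize_poly1P[c c0 ->]]; last first.
  by rewrite rmorph_unit // unitfE.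
have p0 : p != 0 by apply: contra_eq_neq qp => ->; rewrite mulr0 eq_sym oner_eq0.
have q0 : q != 0 by apply: contra_eq_neq qp => ->; rewrite mul0r eq_sym oner_eq0.
move: (congr1 (@mmeasure _ _ mdeg) qp); rewrite msizeM // msize1.
move: p0 q0; rewrite -!msize_poly_eq0.
by case: (msize p) => [|[|a]]; case: (msize q) => [|b] //=; rewrite !addnS.
Qed.

Lemma mpoly_atomic n (p : {mpoly k[n]}) : p != 0 ->
  exists (u : {mpoly k[n]}) (s : seq {mpoly k[n]}),
    [/\ u \is a GRing.unit, forall q, q \in s -> irreducible q &
        p = u * \prod_(q <- s) q].
Proof.
have [m] := ubnP (msize p); elim: m p => // m IH p; rewrite ltnS => sp p0.
have [up|nup] := boolP (p \is a GRing.unit).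
  by exists p, [::]; rewrite big_nil mulr1.
have [irrp|] := pselect (irreducible p).
  exists 1, [:: p]; rewrite unitr1 big_seq1 mul1r; split=> // q.
  by rewrite inE => /eqP ->.
move=> nirr.
have [a [b [epab nua nub]]] : exists a b : {mpoly k[n]},
    [/\ p = a * b, a \isn't a GRing.unit & b \isn't a GRing.unit].
  apply: contrapT => h; apply: nirr; split=> // a b epab.
  have [|nua] := boolP (a \is a GRing.unit); first by left.
  have [|nub] := boolP (b \is a GRing.unit); first by right.
  by case: h; exists a, b.
have a0 : a != 0 by apply: contraNneq p0 => a0; rewrite epab a0 mul0r.
have b0 : b != 0 by apply: contraNneq p0 => b0; rewrite epab b0 mulr0.
have [sa sb] : (msize a < m)%N /\ (msize b < m)%N.
  move: sp; rewrite epab msizeM //; move: nua nub a0 b0.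
  rewrite !mpoly_unit_msize -!msize_poly_eq0.
  case: (msize a) => [|[|x]] //; case: (msize b) => [|[|y]] //.
  rewrite !addSn !addnS /= => _ _ _ _ h; split; apply: leq_trans h; rewrite !ltnS.
    exact: leq_addr.
  exact: leq_addl.
have [u [s [uu irrs ea]]] := IH a sa a0.
have [v [t [uv irrt eb]]] := IH b sb b0.
exists (u * v), (s ++ t); split; first by rewrite unitrM uu.
  by move=> q; rewrite mem_cat => /orP[/irrs|/irrt].
by rewrite epab ea eb big_cat /= mulrACA.
Qed.

(** The inverse of [muni], substituting the last variable back. *)
Definition from_uni n (p : {poly {mpoly k[n]}}) : {mpoly k[n.+1]} :=
  (map_poly (@mwiden n k) p).['X_ord_max].

Lemma from_uni_is_nmod n : nmod_morphism (@from_uni n).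
Proof.
by split=> [|p q]; rewrite /from_uni ?rmorph0 ?horner0 // rmorphD hornerD.
Qed.

Lemma from_uni_is_monoid n : monoid_morphism (@from_uni n).
Proof.
by split=> [|p q]; rewrite /from_uni ?rmorph1 ?hornerE // rmorphM hornerM.
Qed.

HB.instance Definition _ n := GRing.isNmodMorphism.Build
  {poly {mpoly k[n]}} {mpoly k[n.+1]} (@from_uni n) (@from_uni_is_nmod n).
HB.instance Definition _ n := GRing.isMonoidMorphism.Build
  {poly {mpoly k[n]}} {mpoly k[n.+1]} (@from_uni n) (@from_uni_is_monoid n).



Lemma muniXm n (m : 'X_{1..n.+1}) :
  muni ('X_[m] : {mpoly k[n.+1]}) =
  ('X_[[multinom m (widen_ord (leqnSn n) i) | i < n]])%:P * 'X^(m ord_max).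
Proof. by rewrite muniE msuppX big_seq1 mcoeffX eqxx scale1r mul_polyC. Qed.

Lemma from_uniM_Xn n (q : {mpoly k[n]}) j :
  from_uni (q%:P * 'X^j) = mwiden q * 'X_ord_max ^+ j.
Proof.
by rewrite /from_uni rmorphM /= map_polyC /= map_polyXn hornerM hornerC hornerXn.
Qed.

Lemma muniK n : cancel (@muni n k) (@from_uni n).
Proof.
elim/mpolyind => [|c m p _ _ IH]; first by rewrite muni0 raddf0.
rewrite muniD rmorphD /=; congr (_ + _); last exact: IH.
rewrite muniZ muniXm -mul_polyC mulrA -polyCM from_uniM_Xn.
rewrite mul_mpolyC mwidenZ mwidenX -scalerAl mpolyXn -mpolyXD.
congr (_ *: 'X_[_]).
apply/mnmP=> i; rewrite mnmDE mulmnE mnm1E.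
have [ltin|] := ltnP i n; last first.
  move=> leni; have -> : i = ord_max.
    by apply: val_inj; apply/eqP; rewrite eqn_leq leni -ltnS ltn_ord.
  by rewrite mnmwiden_ordmax eqxx mul1n.
have -> : i = widen_ord (leqnSn n) (Ordinal ltin) by apply: val_inj.
rewrite mnmwiden_widen mnmE -val_eqE /=.
by rewrite (gtn_eqF ltin) mul0n addn0.
Qed.

Lemma from_uniK n : cancel (@from_uni n) (@muni n k).
Proof.
move=> p; elim/poly_ind: p => [|p c IH]; first by rewrite !raddf0.
rewrite !(rmorphD, rmorphM) /= IH.
have -> : muni (from_uni 'X) = 'X :> {poly {mpoly k[n]}}.
  rewrite /from_uni map_polyX hornerX muniXm mnm1E eqxx expr1.
  rewrite [X in 'X_[X]](_ : _ = 0%MM) ?mpolyX0 ?mul1r //.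
  apply/mnmP=> i; rewrite mnmE mnm1E mnm0E -val_eqE /=.
  by rewrite (gtn_eqF (ltn_ord i)).
congr (_ + _); rewrite /from_uni map_polyC hornerC /=.
elim/mpolyind: c => [|c m q _ _ IHq]; first by rewrite mwiden0 muni0.
rewrite mwidenD muniD IHq polyCD; congr (_ + q%:P).
rewrite mwidenZ muniZ mwidenX muniXm mnmwiden_ordmax expr0 mulr1.
rewrite -mul_polyC -polyCM.
congr (_%:P); rewrite mul_mpolyC; congr (_ *: 'X_[_]).
by apply/mnmP=> i; rewrite mnmE mnmwiden_widen.
Qed.

(** Gauss's lemma, one variable at a time. *)
Lemma mpoly_irreducible_prime n (p : {mpoly k[n]}) :
  irreducible p -> prime_like p.
Proof.
suff : irreducibles_prime {mpoly k[n]} by exact.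
elim: n {p} => [|n IH].
  move=> p [p0 nup _]; case/negP: nup.
  rewrite mpoly_unit_msize (nvar0_mpolyC p) msizeC; move: p0.
  by rewrite {1}(nvar0_mpolyC p) mpolyC_eq0 => ->.
apply: (iso_irreducibles_prime (@muniK n) (@from_uniK n)).
apply: poly_irreducibles_prime IH; exact: mpoly_atomic.
Qed.

End Factorial.

(** * Directional derivatives and squarefree polynomials *)

Section Derivations.
Variable k : fieldType.
Hypothesis char0 : [pchar k] =i pred0.
Variable n : nat.
Implicit Types (p q F : {mpoly k[n]}) (a : 'rV[k]_n).

Lemma msize_mderiv_le i p : (msize p^`M(i) <= (msize p).-1)%N.
Proof.
rewrite [X in (X <= _)%N]msizeE; apply/bigmax_leqP_seq => m + _.
rewrite mcoeff_msupp mcoeff_deriv => nz.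
have : (m + U_(i))%MM \in msupp p.
  by rewrite mcoeff_msupp; apply: contraNneq nz => ->; rewrite mul0rn.
move/msize_mdeg_lt; rewrite mdegD mdeg1 addn1.
by case: (msize p).
Qed.

(** Characteristic zero enters here: the exponent of a variable that occurs in
    the leading monomial survives as a nonzero coefficient of the derivative. *)
Lemma exists_mderiv_neq0 p : (1 < msize p)%N -> exists i, p^`M(i) != 0.
Proof.
move=> sp; have p0 : p != 0 by rewrite -msize_poly_eq0 -lt0n (ltn_trans _ sp).
have : mdeg (mlead p) != 0%N by rewrite -eqSS mlead_deg // neq_ltn sp orbT.
rewrite mdeg_eq0 => /eqP nz.
have [i hi] : exists i, mlead p i != 0%N.
  apply: contrapT => h; apply: nz; apply/mnmP => i; rewrite mnm0E.
  by apply/eqP; apply: contrapT => hi; apply: h; exists i; apply/negP.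
exists i; apply/eqP => /(congr1 (mcoeff (mlead p - U_(i)))).
rewrite mcoeff_deriv mcoeff0 submK; last by rewrite lep1mP.
move/eqP; rewrite -mulr_natl mulf_eq0 mleadc_eq0 (negbTE p0) orbF.
by rewrite (pcharf0P k).1.
Qed.

Definition dirder a p := \sum_(i < n) a 0 i *: p^`M(i).

Lemma dirderM a p q : dirder a (p * q) = dirder a p * q + p * dirder a q.
Proof.
rewrite /dirder mulr_suml mulr_sumr -big_split /=; apply: eq_bigr => i _.
by rewrite mderivM scalerDr scalerAl scalerAr.
Qed.

Lemma natr_inj_pchar0 : injective (fun i : nat => i%:R : k).
Proof.
move=> i j; wlog leij : i j / (i <= j)%N => [hw|].
  by case/orP: (leq_total i j) => [/hw//|/hw h /esym /h].
move/eqP; rewrite eq_sym -subr_eq0 -natrB // (pcharf0P k).1 // subn_eq0 => leji.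
by apply/eqP; rewrite eqn_leq leij.
Qed.

Lemma exists_nonroot (R : idomainType) (phi : {rmorphism k -> R}) (Q : {poly R}) :
  Q != 0 -> exists c : k, Q.[phi c] != 0.
Proof.
move=> Q0; apply: contrapT => h.
suff : (size [seq phi i%:R | i <- iota 0 (size Q)] < size Q)%N.
  by rewrite size_map size_iota ltnn.
apply: max_poly_roots => //.
  apply/allP => _ /mapP[i _ ->]; apply/eqP; apply: contrapT => /eqP nz.
  by apply: h; exists i%:R.
by rewrite map_inj_uniq ?iota_uniq // => i j /fmorph_inj/natr_inj_pchar0.
Qed.

(** Along the curve [(1, c, c^2, ...)], the directional derivative of [p] is a
    nonzero polynomial in [c], so only finitely many [c] are bad for the
    given finite list. *)
Lemma generic_direction (s : seq {mpoly k[n]}) :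
    (forall p, p \in s -> (1 < msize p)%N) ->
  exists a, forall p, p \in s -> dirder a p != 0.
Proof.
move=> ncst.
pose Q p : {poly {mpoly k[n]}} := \sum_(i < n) (p^`M(i)) *: 'X^i.
have Q0 p : p \in s -> Q p != 0.
  move=> /ncst/exists_mderiv_neq0[i nz]; apply: contraNneq nz.
  move=> /(congr1 (fun q : {poly _} => q`_i)).
  rewrite coef0 coef_sum (bigD1 i) //= coefZ coefXn eqxx mulr1.
  rewrite big1 ?addr0 => [->//|j ne]; rewrite coefZ coefXn -val_eqE /= in ne *.
  by rewrite eq_sym (negbTE ne) mulr0.
(* [Q p] is the derivative of [p] in the direction of the curve at parameter
   ['X]. *)
have : \prod_(p <- s) Q p != 0.
  by rewrite prodf_seq_neq0; apply/allP => p ps /=; apply: Q0.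
case/(@exists_nonroot _ (@mpolyC n k)) => c; rewrite horner_prod => nz.
exists (\row_i c ^+ i) => p ps.
have := nz; rewrite prodf_seq_neq0 => /allP /(_ p ps) /=.
rewrite /dirder /Q horner_sum.
suff -> : \sum_(i < n) ((p^`M(i)) *: 'X^i).[c%:MP] =
  \sum_(i < n) (\row_i c ^+ i) 0 i *: p^`M(i) by [].
by apply: eq_bigr => i _; rewrite hornerZ hornerXn mxE -mul_mpolyC rmorphXn mulrC.
Qed.

Lemma msize_dirder_le a p : (msize (dirder a p) <= (msize p).-1)%N.
Proof.
rewrite /dirder; elim/big_ind: _ => [|x y sx sy|i _]; first by rewrite msize0.
  by apply: leq_trans (msizeD_le _ _) _; rewrite geq_max sx sy.
exact: leq_trans (msizeZ_le _ _) (msize_mderiv_le i p).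
Qed.

Lemma msize_divides p q : q != 0 -> divides p q -> (msize p <= msize q)%N.
Proof.
move=> q0 [c e]; move: q0; rewrite e mulf_eq0 negb_or => /andP[p0 c0].
rewrite msizeM //; move: c0; rewrite -msize_poly_eq0.
by case: (msize c) => // m _; rewrite addnS leq_addr.
Qed.

Lemma irreducible_msize p : irreducible p -> (1 < msize p)%N.
Proof.
case=> p0 + _; rewrite mpoly_unit_msize; move: p0; rewrite -msize_poly_eq0.
by case: (msize p) => [|[]].
Qed.

Lemma divides_unitl (R : idomainType) (u p q : R) : u \is a GRing.unit ->
  divides p q -> divides (u * p) q.
Proof.
by move=> uu [c ->]; exists (u^-1 * c); rewrite mulrCA !mulrA mulVr ?mul1r.
Qed.

Lemma squarefree_divides (s : seq {mpoly k[n]}) B :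
    (forall p, p \in s -> irreducible p) ->
    (forall p, irreducible p -> ~ divides (p * p) (\prod_(q <- s) q)) ->
    (forall p, p \in s -> divides p B) ->
  divides (\prod_(p <- s) p) B.
Proof.
elim: s B => [|p s IH] B irrs sqf divB.
  by exists B; rewrite big_nil mul1r.
have [|q qirr dq|q qs|C eB] := IH B.
- by move=> q qs; apply: irrs; rewrite inE qs orbT.
- by apply: (sqf q qirr); rewrite big_cons; apply: divides_mull.
- by apply: divB; rewrite inE qs orbT.
have irrp := irrs p (mem_head p s).
have := divB p (mem_head p s); rewrite eB => /(mpoly_irreducible_prime irrp).
case=> [[w ew]|[w ew]].
  by case: (sqf p irrp); exists w; rewrite big_cons ew mulrA.
by exists w; rewrite big_cons ew mulrCA mulrA.
Qed.

End Derivations.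

(** * Singular points of a form with a double factor *)

Section Cone.
Variable k : fieldType.
Hypothesis char0 : [pchar k] =i pred0.
Variable n : nat.
Implicit Types (p q f F u : {mpoly k[n]}) (v : 'I_n -> k).

Lemma mderiv_homog d i f : f \is d.-homog -> f^`M(i) \is d.-1.-homog.
Proof.
move=> /dhomogP homf; apply/dhomogP => m.
rewrite mcoeff_msupp mcoeff_deriv => nz.
have /homf : (m + U_(i))%MM \in msupp f.
  by rewrite mcoeff_msupp; apply: contraNneq nz => ->; rewrite mul0rn.
by move=> /= <-; rewrite mdegD mdeg1 addn1.
Qed.

Lemma meval_homog d f c v : f \is d.-homog ->
  f.@[fun i => c * v i] = c ^+ d * f.@[v].
Proof.
move=> /dhomogP homf; rewrite !mevalE mulr_sumr; apply: eq_big_seq => m ms.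
have <- : mdeg m = d by exact: homf.
rewrite mdegE -prodrXr mulrCA; congr (_ * _).
by rewrite -big_split /=; apply: eq_bigr => i _; rewrite exprMn.
Qed.

Lemma homog_msizeE d f : f != 0 -> f \is d.-homog -> msize f = d.+1.
Proof.
move=> f0 hf; rewrite -(mlead_deg f0); congr _.+1.
exact: (dhomog_mf hf (mlead_supp f0)).
Qed.

(** On the line spanned by [v], [u] is a polynomial in the scalar whose
    coefficients are the values at [v] of the homogeneous components of [u];
    it has infinitely many roots. *)
Lemma cone_pihomog_eq0 u v e :
  (forall c, u.@[fun i => c * v i] = 0) -> (pihomog mdeg e u).@[v] = 0.
Proof.
move=> zu.
pose P := \poly_(j < msize u) (pihomog mdeg j u).@[v].
suff P0 : P = 0.
  have [lte|lee] := ltnP e (msize u).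
    by have := congr1 (fun q : {poly k} => q`_e) P0; rewrite coef_poly lte coef0.
  rewrite /pihomog big_seq_cond big1 ?meval0 // => m.
  move=> /andP[/msize_mdeg_lt + /eqP em].
  by rewrite em ltnNge lee.
apply: contrapT => /eqP; case/(exists_nonroot char0 idfun) => c.
case/negP; apply/eqP; rewrite horner_poly -[RHS](zu c).
rewrite [in RHS](pihomog_partitionE (mf := mdeg) (leqnn (msize u))) raddf_sum /=.
by apply: eq_bigr => j _; rewrite (meval_homog _ _ (pihomogP _ _ _)) mulrC.
Qed.

Lemma homog_component_neq0 u : u != 0 ->
  exists2 e, (e < msize u)%N & pihomog mdeg e u != 0.
Proof.
move=> u0; apply: contrapT => h; case/eqP: u0.
rewrite (pihomog_partitionE (mf := mdeg) (leqnn (msize u))) big1 // => e _.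
by apply/eqP; apply: contrapT => nz; apply: h; exists e => //; apply/negP.
Qed.

(** If [F = p^2 q] then, at a singular point of [F] where [p] does not vanish,
    [q] is singular as well. So [p] times a derivative of [q] vanishes at every
    singular point of [F], and the degree has dropped by [deg p + 1]. When [q]
    is constant, [p] does the job, having half the degree of [F]. *)
Lemma double_factor_divisor F p q :
    F = p * p * q -> F != 0 -> (1 < msize p)%N -> (3 < msize F)%N ->
  exists2 u, u != 0 & (msize u < (msize F).-1)%N /\
    forall v, F.@[v] = 0 -> (forall i, F^`M(i).@[v] = 0) -> u.@[v] = 0.
Proof.
move=> eF F0 sp sF.
have p0 : p != 0 by apply: contraNneq F0 => p0; rewrite eF p0 !mul0r.
have q0 : q != 0 by apply: contraNneq F0 => q0; rewrite eF q0 !mulr0.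
have sFE : msize F = (msize p + msize p + msize q).-2.
  rewrite eF !msizeM ?mulf_neq0 //.
  by case: (msize p) sp => // a _; rewrite addSn.
have [sq|sq] := ltnP 1 (msize q); last first.
  have eq1 : msize q = 1%N.
    by move: q0 sq; rewrite -msize_poly_eq0; case: (msize q) => [|[]].
  exists p => //; split.
    by move: sF; rewrite sFE eq1; lia.
  have [c c0 eq] : exists2 c, c != 0 & q = c%:MP.
    by apply/msize_poly1P; rewrite eq1.
  move=> v; rewrite eF eq !mevalM => /eqP.
  have [->//|pv] := eqVneq p.@[v] 0.
  by rewrite !mulf_eq0 (negbTE pv) mevalC (negbTE c0).
have [i dq0] := exists_mderiv_neq0 char0 sq.
exists (p * q^`M(i)); first by rewrite mulf_neq0.
split.
  rewrite msizeM // sFE.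
  have := msize_mderiv_le i q; move: sp sq.
  by move: (mmeasure _ p) (mmeasure _ q) (mmeasure _ q^`M(i)) => a b e; lia.
move=> v Fv /(_ i).
rewrite mevalM eF !mderivM !(mevalD, mevalM).
have [->|pv] := eqVneq p.@[v] 0; first by move=> _; rewrite mul0r.
have -> : q.@[v] = 0.
  move: Fv; rewrite eF !mevalM => /eqP.
  by rewrite !mulf_eq0 (negbTE pv) /= => /eqP.
rewrite mulr0 add0r => /eqP; rewrite !mulf_eq0 (negbTE pv) /= => /eqP ->.
by rewrite mulr0.
Qed.

End Cone.

(** * Linear forms in three variables *)

Lemma dim_dhomog3 (k : fieldType) t : \dim {: dhomog 3 k t} = 'C(t + 2, 2).
Proof. by rewrite dimvf /dim /= -[RHS]bin_sub ?leq_addl // addnK. Qed.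

Section LinearForms.
Variable k : fieldType.
Implicit Types v w : 'rV[k]_3.

Definition linform (c : 'cV[k]_3) : {mpoly k[3]} := \sum_(i < 3) c i 0 *: 'X_i.

Lemma linform_homog c : linform c \is 1.-homog.
Proof. by apply: rpred_sum => i _; apply: rpredZ; rewrite dhomogX /= mdeg1. Qed.

Lemma linform_meval c v : (linform c).@[v 0] = (v *m c) 0 0.
Proof.
rewrite /linform raddf_sum mxE /=; apply: eq_bigr => i _.
by rewrite mevalZ mevalXU mulrC.
Qed.

Lemma mderiv_linform i c : (linform c)^`M(i) = (c i 0)%:MP.
Proof.
rewrite /linform raddf_sum /= (bigD1 i) //= big1 ?addr0 => [|j ne].
  rewrite mderivZ mderivX mnm1E eqxx scale1r -[X in (X - _)%MM]add0m addmK.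
  by rewrite mpolyX0 -mul_mpolyC mulr1.
by rewrite mderivZ mderivX mnm1E (negbTE ne) scale0r scaler0.
Qed.

Lemma linform_dirder c w v : (dirder w (linform c)).@[v 0] = (w *m c) 0 0.
Proof.
rewrite /dirder raddf_sum mxE /=; apply: eq_bigr => i _.
by rewrite mevalZ mderiv_linform mevalC.
Qed.

Lemma exists_linform v w a b : v != 0 -> w \notin <[v]>%VS ->
  exists c : 'cV[k]_3, (v *m c) 0 0 = a /\ (w *m c) 0 0 = b.
Proof.
move=> v0 wv.
have /row_freeP[M] : row_free (col_mx v w).
  apply: inj_row_free => u; rewrite -[u]hsubmxK mul_row_col.
  rewrite [lsubmx u]mx11_scalar [rsubmx u]mx11_scalar !mul_scalar_mx.
  set x := lsubmx u 0 0; set y := rsubmx u 0 0 => e.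
  have y0 : y = 0.
    apply: contraNeq wv => y0; apply/vlineP; exists (- (y^-1 * x)).
    apply: (scalerI y0); rewrite scalerA mulrN mulrA divff // mul1r scaleNr.
    by apply/eqP; rewrite -addr_eq0 addrC e.
  move: e; rewrite y0 scale0r addr0 => /eqP.
  rewrite scaler_eq0 (negbTE v0) orbF => /eqP ->.
  by rewrite raddf0 row_mx0.
rewrite mul_col_mx -[1%:M]/(1%:M : 'M_(1 + 1)) scalar_mx_block.
case/eq_col_mx=> ev ew.
exists (M *m col_mx a%:M b%:M).
rewrite !mulmxA ev ew !mul_row_col !mul1mx !mul0mx.
by rewrite addr0 add0r !mxE.
Qed.

(** Two dimensions in the kernel of a linear form on a three-dimensional space
    leave room outside any given line. *)
Lemma exists_tangent v (c : 'cV[k]_3) :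
  exists2 w : 'rV[k]_3, w \notin <[v]>%VS & (w *m c) 0 0 = 0.
Proof.
pose K := lker (linfun (mulmxr c : 'rV[k]_3 -> 'rV[k]_1)).
have dK : (1 < \dim K)%N.
  have := limg_ker_dim (linfun (mulmxr c : 'rV[k]_3 -> 'rV[k]_1)) fullv.
  rewrite capfv dimvf /dim /= mul1n -/K.
  have := dimvS (subvf (linfun (mulmxr c : 'rV[k]_3 -> 'rV[k]_1) @: fullv)%VS).
  rewrite dimvf /dim /= mul1n; lia.
have /subvPn[w] : ~~ (K <= <[v]>)%VS.
  apply/negP => /dimvS; rewrite dim_vline => h.
  by move: (leq_trans dK h); case: (v != 0).
by rewrite /K memv_ker lfunE /= => /eqP e nw; exists w => //; rewrite e mxE.
Qed.
End LinearForms.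

(** * Syzygies between a form and its derivative *)

Section Counting.
Variable k : fieldType.

Lemma dirder_is_linear n (a : 'rV[k]_n) : linear (@dirder k n a).
Proof.
move=> c p q; rewrite /dirder scaler_sumr -big_split /=; apply: eq_bigr => i _.
by rewrite mderivD mderivZ scalerDr !scalerA [a 0 i * c]mulrC.
Qed.

HB.instance Definition _ n (a : 'rV[k]_n) := GRing.isLinear.Build k
  {mpoly k[n]} {mpoly k[n]} _ (dirder a) (dirder_is_linear a).

Lemma dirder_homog n (a : 'rV[k]_n) d (p : {mpoly k[n]}) :
  p \is d.-homog -> dirder a p \is d.-1.-homog.
Proof.
by move=> hp; apply: rpred_sum => i _; apply: rpredZ; apply: mderiv_homog.
Qed.

Section Syzygies.
Variables (m : nat) (F : dhomog 3 k m.+1) (G : dhomog 3 k m).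

(** Its kernel consists of the syzygies between [F] and [G]. The value is built
    with [indhomog], which is harmless because the form always has the right
    degree ([val_syzygy_map]). *)
Definition syzygy_map (e : dhomog 3 k m * dhomog 3 k m.+1) :
    dhomog 3 k (m + m.+1) :=
  indhomog (m + m.+1) (mpoly_of_dhomog e.1 * mpoly_of_dhomog F
                       - mpoly_of_dhomog e.2 * mpoly_of_dhomog G).

Lemma val_syzygy_map e :
  mpoly_of_dhomog (syzygy_map e) =
  mpoly_of_dhomog e.1 * mpoly_of_dhomog F
  - mpoly_of_dhomog e.2 * mpoly_of_dhomog G.
Proof.
rewrite /syzygy_map /indhomog -[LHS]/(val _) insubdK //.
change (mpoly_of_dhomog e.1 * mpoly_of_dhomog F
        - mpoly_of_dhomog e.2 * mpoly_of_dhomog G \is (m + m.+1).-homog).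
apply: rpredB; first exact: (dhomogM (dhomog_is_dhomog e.1) (dhomog_is_dhomog F)).
by rewrite addnC; exact: (dhomogM (dhomog_is_dhomog e.2) (dhomog_is_dhomog G)).
Qed.

Lemma syzygy_map_is_linear : linear syzygy_map.
Proof.
move=> c e e'; apply: val_inj => /=; rewrite !val_syzygy_map /=.
by rewrite scalerBr !mulrDl -!scalerAl opprD addrACA.
Qed.

HB.instance Definition _ := GRing.isLinear.Build k
  (dhomog 3 k m * dhomog 3 k m.+1)%type (dhomog 3 k (m + m.+1)) _ syzygy_map
  syzygy_map_is_linear.

End Syzygies.

Section Jets.
Variables (t s : nat) (x w : 'I_s -> 'rV[k]_3).

(** Of the first-order jet at [x i], only the value and the derivative in the
    one direction [w i] are recorded. *)
Definition jet_map (h : dhomog 3 k t) : 'rV[k]_s * 'rV[k]_s :=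
  (\row_i (mpoly_of_dhomog h).@[x i 0],
   \row_i (dirder (w i) (mpoly_of_dhomog h)).@[x i 0]).

Lemma jet_map_is_linear : linear jet_map.
Proof.
move=> c g h; rewrite /jet_map; congr pair; apply/rowP => i; rewrite !mxE /=.
  by rewrite mevalD mevalZ.
by rewrite dirder_is_linear mevalD mevalZ.
Qed.

HB.instance Definition _ := GRing.isLinear.Build k
  (dhomog 3 k t) ('rV[k]_s * 'rV[k]_s)%type _ jet_map jet_map_is_linear.

End Jets.

Section Onto.
Variables (m s : nat) (x w : 'I_s -> 'rV[k]_3).
Hypothesis x0 : forall i, x i != 0.
Hypothesis wx : forall i, w i \notin <[x i]>%VS.
Hypothesis sep : forall i, exists2 f : {mpoly k[3]}, f \is m.-homog &
  forall j, f.@[x j 0] = (i == j)%:R.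

(** If [f] separates [x i] from the other points then [f^2] vanishes doubly at
    those, and multiplying it by a linear form with prescribed values at [x i]
    and [w i] realizes any jet at [x i]. *)
Lemma jet_separator i (a b : k) : exists h : dhomog 3 k (m + m.+1),
  jet_map x w h = (a *: delta_mx 0 i, b *: delta_mx 0 i).
Proof.
have [f hf ef] := sep i.
(* The derivative of [f^2 * l] along [w i] is [2 * f' * l(x i) + l(w i)] at
   [x i], where [f'] is the derivative of [f]. *)
have [c [cx cw]] := exists_linform a
  (b - 2%:R * a * (dirder (w i) f).@[x i 0]) (x0 i) (wx i).
have hom : f * (f * linform c) \is (m + m.+1).-homog.
  by rewrite -[m.+1]addn1; do 2!apply: dhomogM => //; apply: linform_homog.
exists (DHomog hom); rewrite /jet_map.
congr pair; apply/rowP => j; rewrite !mxE /=.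
  rewrite !mevalM !ef linform_meval eq_sym.
  by case: eqVneq => [->|_]; rewrite ?cx ?mul0r ?mulr0 // mulr1 !mul1r.
rewrite !dirderM !(mevalD, mevalM) !ef linform_meval eq_sym linform_dirder.
case: eqVneq => [->|_]; last by rewrite !(mul0r, mulr0, addr0).
by rewrite cx cw !mulr1n; ring.
Qed.

Lemma jet_map_onto : limg (linfun (jet_map (t := m + m.+1) x w)) = fullv.
Proof.
apply/eqP; rewrite eqEsubv subvf /=; apply/subvP => -[a b] _.
have /choice[h hh] : forall i, exists h : dhomog 3 k (m + m.+1),
    jet_map x w h = (a 0 i *: delta_mx 0 i, b 0 i *: delta_mx 0 i).
  by move=> i; apply: jet_separator.
suff -> : (a, b) = linfun (jet_map (t := m + m.+1) x w) (\sum_i h i).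
  by rewrite memv_img ?memvf.
rewrite lfunE raddf_sum /= (eq_bigr _ (fun i _ => hh i)).
rewrite [a in LHS]row_sum_delta [b in LHS]row_sum_delta.
by elim/big_rec3: _ => // i y1 y2 y3 _ <-.
Qed.

End Onto.

Lemma mul2_bin2 n : (2 * 'C(n + 2, 2) = (n + 2) * (n + 1))%N.
Proof.
elim: n => [//|n IH]; rewrite addSn binS mulnDr IH bin1; lia.
Qed.

(** A substitute for Bezout's theorem. A form [A * F - B * D_a F], with [F]
    singular at [x i], vanishes at [x i], and its differential there is
    proportional to that of [D_a F], so it is zero on a direction [w i]
    tangent to [D_a F]. These two conditions at each point are independent
    in degree [2m+1] since [jet_map] is onto, hence the kernel of
    [syzygy_map] has dimension at least [2s + 1 - m(m+1) >= 3], and cannot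
    be the line of multiples of [(D_a F, F)]. *)
Lemma nontrivial_syzygy m s (x : 'I_s -> 'rV[k]_3) (a : 'rV[k]_3)
    (F : {mpoly k[3]}) :
    (m * m.+1 + 2 <= 2 * s)%N -> (forall i, x i != 0) ->
    (forall i, exists2 f : {mpoly k[3]}, f \is m.-homog &
      forall j, f.@[x j 0] = (i == j)%:R) ->
    F \is m.+1.-homog -> (forall i, F.@[x i 0] = 0) ->
    (forall i l, F^`M(l).@[x i 0] = 0) ->
  exists A B : {mpoly k[3]},
    [/\ A * F = B * dirder a F, B \is m.+1.-homog &
        forall c, (A, B) <> (c *: dirder a F, c *: F)].
Proof.
move=> ms x0 sep hF F0 dF0; set G := dirder a F.
have hG : G \is m.-homog by apply: (dirder_homog a hF).
have /choice[w hw] : forall i, exists w : 'rV[k]_3,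
    w \notin <[x i]>%VS /\ (w *m (\col_l G^`M(l).@[x i 0])) 0 0 = 0.
  move=> i.
  by have [w wx e] := exists_tangent (x i) (\col_l G^`M(l).@[x i 0]); exists w.
have dF v i : (dirder v F).@[x i 0] = 0.
  by rewrite /dirder raddf_sum big1 // => l _ /=; rewrite mevalZ dF0 mulr0.
have dG i : (dirder (w i) G).@[x i 0] = 0.
  rewrite -[RHS](hw i).2 /dirder raddf_sum mxE; apply: eq_bigr => l _ /=.
  by rewrite mevalZ mxE.
pose Phi := linfun (syzygy_map (DHomog hF) (DHomog hG)).
pose Psi := linfun (jet_map (t := m + m.+1) x w).
have PsiPhi : (limg Phi <= lker Psi)%VS.
  apply/subvP => _ /memv_imgP[e _ ->].
  rewrite memv_ker !lfunE /= /jet_map val_syzygy_map; apply/eqP.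
  congr pair; apply/rowP => i; rewrite !mxE.
    by rewrite mevalB !mevalM F0 dF !mulr0 subrr.
  rewrite linearB /= !dirderM !(mevalB, mevalD, mevalM) F0 !dF dG.
  by rewrite !mulr0 !addr0 subrr.
have rPsi := limg_ker_dim Psi fullv.
have rPhi := limg_ker_dim Phi fullv.
have := dimvS PsiPhi.
move: rPsi rPhi; rewrite !capfv jet_map_onto //; last by move=> i; case: (hw i).
rewrite dim_dhomog3.
have -> : \dim {: ('rV[k]_s * 'rV[k]_s)%type} = (s + s)%N.
  by rewrite dimvf /dim /= /dim /= !mul1n.
have -> : \dim {: (dhomog 3 k m * dhomog 3 k m.+1)%type} =
    ('C(m + 2, 2) + 'C(m.+1 + 2, 2))%N.
  by rewrite -!(dim_dhomog3 k) !dimvf.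
have := mul2_bin2 m; have := mul2_bin2 m.+1; have := mul2_bin2 (m + m.+1).
move=> b1 b2 b3 r1 r2 r3.
have {b1 b2 b3 r1 r2 r3 ms}dimK : (1 < \dim (lker Phi))%N by nia.
have /subvPn[[A B]] : ~~ (lker Phi <= <[(DHomog hG, DHomog hF)]>)%VS.
  apply/negP => /dimvS; rewrite dim_vline => h.
  by move: (leq_trans dimK h); case: (_ != 0).
rewrite memv_ker lfunE => /eqP/(congr1 val); rewrite /= val_syzygy_map /= => e nt.
exists (mpoly_of_dhomog A), (mpoly_of_dhomog B); split.
- by apply/eqP; rewrite -subr_eq0 e.
- exact: dhomog_is_dhomog.
- move=> c [eA eB]; case/negP: nt; apply/vlineP; exists c.
  by congr pair; apply: val_inj.
Qed.

End Counting.

(** * Forms singular at many points *)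

Section Core.
Variable k : fieldType.
Hypothesis char0 : [pchar k] =i pred0.

(** Modulo an irreducible factor [p] of [F], the derivative [D_a F] is the
    product of [D_a p] and of the cofactor of [p]. Here [D_a p] is nonzero of
    smaller degree than [p], and the cofactor is prime to [p], so [p] must
    divide [B]. The irreducible factors of [F] being distinct, [F] divides
    [B]. *)
Lemma squarefree_syzygy n (F A B : {mpoly k[n]}) (u : {mpoly k[n]}) s a :
    F = u * \prod_(p <- s) p -> u \is a GRing.unit ->
    (forall p, p \in s -> irreducible p) ->
    (forall p, p \in s -> dirder a p != 0) ->
    (forall p, irreducible p -> ~ divides (p * p) F) ->
    A * F = B * dirder a F -> divides F B.
Proof.
move=> eF uu irrs das sqf eAB; rewrite eF; apply: divides_unitl => //.
apply: squarefree_divides => // [p irrp dp|p ps].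
  by apply: (sqf p irrp); rewrite eF; apply: divides_mull.
have irrp := irrs p ps; have [p0 nup _] := irrp.
pose P' := u * \prod_(q <- rem p s) q.
have eFp : F = p * P' by rewrite eF (big_rem p) //= mulrCA.
have := mpoly_irreducible_prime irrp (a := B) (b := dirder a F); case=> //.
  by exists (A * P'); rewrite -eAB eFp mulrCA.
rewrite eFp dirderM addrC => d1.
have d2 : divides p (p * dirder a P') by exists (dirder a P').
case/(mpoly_irreducible_prime irrp): (divides_addl d2 d1).
  move/(msize_divides (das p ps)) => h.
  have := leq_trans h (msize_dirder_le a p); have := irreducible_msize irrp.
  by lia.
by case=> c ec; case: (sqf p irrp); exists c; rewrite eFp ec mulrA.
Qed.

(** With [F] squarefree, [B] would be a multiple of [F] of the same degree, so
    that the syzygy would be a trivial one. *)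
Lemma repeated_factor m s (x : 'I_s -> 'rV[k]_3) (F : {mpoly k[3]}) :
    (m * m.+1 + 2 <= 2 * s)%N -> (forall i, x i != 0) ->
    (forall i, exists2 f : {mpoly k[3]}, f \is m.-homog &
      forall j, f.@[x j 0] = (i == j)%:R) ->
    F != 0 -> F \is m.+1.-homog -> (forall i, F.@[x i 0] = 0) ->
    (forall i l, F^`M(l).@[x i 0] = 0) ->
  exists2 p, irreducible p & divides (p * p) F.
Proof.
move=> ms x0 sep F0 hF Fx dFx; apply: contrapT => nsq.
have sqf p : irreducible p -> ~ divides (p * p) F.
  by move=> irrp dp; apply: nsq; exists p.
have [u [t [uu irrt eF]]] := mpoly_atomic F0.
have [|a ha] := @generic_direction _ char0 3 t.
  by move=> p /irrt/irreducible_msize.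
have [A [B [eAB hB nt]]] := nontrivial_syzygy a ms x0 sep hF Fx dFx.
have [C eB] := squarefree_syzygy eF uu irrt ha sqf eAB.
have [c eC] : exists c, C = c%:MP.
  have [->|C0] := eqVneq C 0; first by exists 0; rewrite mpolyC0.
  have B0 : B != 0 by rewrite eB mulf_neq0.
  exists C@_0; apply: msize1_polyC.
  have := homog_msizeE B0 hB; rewrite eB msizeM // (homog_msizeE F0 hF).
  by lia.
apply: (nt c); congr pair; last by rewrite eB eC mulrC mul_mpolyC.
apply: (mulIf F0); rewrite eAB eB eC -mul_mpolyC.
by rewrite -mulrA mulrC.
Qed.

(** The form given by [double_factor_divisor] need not be homogeneous. But it
    vanishes on the lines spanned by the [x i], hence so do its homogeneous
    components, and a nonzero one can be multiplied by a power of a variable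
    to reach degree [m-1]. *)
Lemma no_singular_form m s (x : 'I_s -> 'rV[k]_3) (F : {mpoly k[3]}) :
    (1 < m)%N -> (m * m.+1 + 2 <= 2 * s)%N -> (forall i, x i != 0) ->
    (forall g : {mpoly k[3]}, g \is m.-1.-homog ->
      (forall i, g.@[x i 0] = 0) -> g = 0) ->
    (forall i, exists2 f : {mpoly k[3]}, f \is m.-homog &
      forall j, f.@[x j 0] = (i == j)%:R) ->
    F \is m.+1.-homog -> (forall i, F.@[x i 0] = 0) ->
    (forall i l, F^`M(l).@[x i 0] = 0) ->
  F = 0.
Proof.
move=> m1 ms x0 inj sep hF Fx dFx; apply/eqP; apply: contrapT => /negP F0.
have [p irrp [q eF]] := repeated_factor ms x0 sep F0 hF Fx dFx.
have sF := homog_msizeE F0 hF.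
have sp := irreducible_msize irrp.
have [|u u0 [su hu]] := double_factor_divisor char0 eF F0 sp.
  by rewrite sF.
have [e eu nz] := homog_component_neq0 u0.
have ele : (e <= m.-1)%N.
  by move: su eu; rewrite sF; move: (mmeasure _ u) => a; lia.
have X0 : 'X_ord0 != 0 :> {mpoly k[3]} by rewrite -msize_poly_eq0 msizeX.
case/negP: (mulf_neq0 nz (expf_neq0 (m.-1 - e) X0)); apply/eqP/inj.
  rewrite -[X in X.-homog](subnKC ele); apply: dhomogM; first exact: pihomogP.
  rewrite -[X in X.-homog]mul1n; apply: dhomogMn.
  by rewrite dhomogX /= mdeg1.
move=> i; rewrite mevalM (cone_pihomog_eq0 char0) ?mul0r // => c.
apply: hu; first by rewrite (meval_homog _ _ hF) Fx mulr0.
by move=> l; rewrite (meval_homog _ _ (mderiv_homog l hF)) dFx mulr0.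
Qed.

End Core.

(** * Hilbert functions of sets of points *)

Section Dimension.
Variables (k : fieldType) (V : vectType k).
Implicit Types S : set V.

(** This turns forms found in an ideal of points into an upper bound for its
    Hilbert function. *)
Lemma dim_le_setdim (U : {vspace V}) S :
  (forall v, v \in U -> S v) -> (\dim U <= setdim S)%N.
Proof.
move=> US; have ltU : (\dim U < (\dim {:V}).+1)%N by rewrite ltnS dimvS ?subvf.
apply: (@leq_bigmax_cond _ _
  (fun m : 'I_(\dim {:V}).+1 => m : nat) (Ordinal ltU)).
apply/asboolP; exists (vbasis U); split; first exact: basis_free (vbasisP U).
by move=> v /vbasis_mem/US.
Qed.

Lemma setdim_eq0 S : (forall v, S v -> v = 0) -> setdim S = 0%N.
Proof.
move=> S0; apply/eqP; rewrite -leqn0.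
apply/bigmax_leqP => -[m ltm] /= /asboolP[b [fb bS]].
case: m b fb bS {ltm} => // m b fb bS.
have : 0 \in b by rewrite -(S0 _ (bS _ (mem_tnth ord0 b))) mem_tnth.
by move/(free_not0 fb); rewrite eqxx.
Qed.

End Dimension.

Section Points.
Variable k : fieldType.
Implicit Types (P : P2 k) (f : {mpoly k[3]}).

Definition rep P : 'rV[k]_3 := vpick (P : {vspace _}).

Lemma rep_neq0 P : rep P != 0.
Proof.
rewrite vpick0 -dimv_eq0; case: P => U /= dU.
by rewrite (eqP dU).
Qed.

Lemma rep_hom_coords P : hom_coords P (rep P).
Proof. by split; [exact: memv_pick | exact: rep_neq0]. Qed.

Lemma hom_coords_rep P v : v \in (P : {vspace _}) -> exists c, v = c *: rep P.
Proof.
have -> : (P : {vspace _}) = <[rep P]>%VS.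
  apply/esym/eqP; rewrite eqEdim -memvE memv_pick /= dim_vline rep_neq0.
  by case: P => U /= /eqP ->.
by move/vlineP.
Qed.

Lemma vanishing_point_ideal P f e :
  f \is e.-homog -> f.@[rep P 0] = 0 -> point_ideal P f.
Proof.
move=> hf fP; exists 1%N, (fun=> 1), (fun=> f).
split; last by rewrite big_ord1 mul1r.
move=> _; split; first by exists e.
move=> v [/hom_coords_rep[c ->] _].
rewrite -[RHS](mulr0 (c ^+ e)) -fP -(meval_homog c _ hf).
by apply: meval_eq => i; rewrite mxE.
Qed.

Lemma point_ideal_meval P f : point_ideal P f -> f.@[rep P 0] = 0.
Proof.
case=> m [a [g [hg ->]]]; rewrite raddf_sum big1 // => i _ /=.
by rewrite mevalM (hg i).2 ?mulr0 //; apply: rep_hom_coords.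
Qed.

Lemma double_point_ideal_singular P f :
  ideal_mul (point_ideal P) (point_ideal P) f ->
  f.@[rep P 0] = 0 /\ forall l, f^`M(l).@[rep P 0] = 0.
Proof.
case=> m [a [g [hg ->]]].
have {}hg i : (g i).@[rep P 0] = 0 /\ forall l, (g i)^`M(l).@[rep P 0] = 0.
  have [p /point_ideal_meval pP [q /point_ideal_meval qP <-]] := hg i.
  split=> [|l]; first by rewrite mevalM pP mul0r.
  by rewrite mderivM mevalD !mevalM pP qP mulr0 mul0r addr0.
split=> [|l].
  by rewrite raddf_sum big1 // => i _ /=; rewrite mevalM (hg i).1 mulr0.
elim/big_rec: _ => [|i h _ IH]; first by rewrite mderiv0 meval0.
rewrite mderivD mevalD IH addr0 mderivM mevalD !mevalM (hg i).1 (hg i).2.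
by rewrite !mulr0 addr0.
Qed.

Section Evaluation.
Variable X : {fset P2 k}.

Definition point (i : 'I_#|` X|) : P2 k := tnth (in_tuple (enum_fset X)) i.

Lemma point_mem i : point i \in X.
Proof. exact: mem_tnth. Qed.

Lemma mem_point P : P \in X -> exists i, P = point i.
Proof. by move=> PX; apply/tnthP. Qed.

Definition evaluation t (h : dhomog 3 k t) : 'rV[k]_(#|` X|) :=
  \row_i (mpoly_of_dhomog h).@[rep (point i) 0].

Lemma evaluation_is_linear t : linear (@evaluation t).
Proof. by move=> c g h; apply/rowP => i; rewrite !mxE mevalD mevalZ. Qed.

HB.instance Definition _ t := GRing.isLinear.Build k
  (dhomog 3 k t) 'rV[k]_(#|` X|) _ (@evaluation t) (@evaluation_is_linear t).

(** Forms in the kernel of the evaluation at the points belong to the ideal,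
    which bounds the Hilbert function by the rank of the evaluation. *)
Lemma H_pts_le_rank t : (H_pts X t <= \dim (limg (linfun (@evaluation t))))%N.
Proof.
rewrite /H_pts /hilbert -(limg_ker_dim (linfun (@evaluation t)) fullv) capfv.
rewrite leq_subLR leq_add2r; apply: dim_le_setdim => h.
rewrite memv_ker lfunE /= => /eqP h0 P /= /mem_point[i ->].
apply: vanishing_point_ideal (dhomog_is_dhomog h) _.
by move/rowP: h0 => /(_ i); rewrite !mxE.
Qed.

Lemma evaluation_injective t g : H_pts X t = 'C(t + 2, 2) ->
  g \is t.-homog -> (forall i, g.@[rep (point i) 0] = 0) -> g = 0.
Proof.
move=> Ht hg g0; have := H_pts_le_rank t.
rewrite Ht -(dim_dhomog3 k) -(limg_ker_dim (linfun (@evaluation t)) fullv) capfv.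
rewrite -[leqRHS]add0n leq_add2r leqn0 dimv_eq0 => /eqP ker0.
have : DHomog hg \in lker (linfun (@evaluation t)).
  by rewrite memv_ker lfunE; apply/eqP/rowP => i; rewrite !mxE.
by rewrite ker0 memv0 => /eqP/(congr1 val).
Qed.

Lemma evaluation_surjective t : H_pts X t = #|` X| ->
  forall i, exists2 f : {mpoly k[3]}, f \is t.-homog &
    forall j, f.@[rep (point j) 0] = (i == j)%:R.
Proof.
move=> Ht i; have := H_pts_le_rank t; rewrite Ht => full.
have : delta_mx 0 i \in limg (linfun (@evaluation t)).
  suff /eqP -> : limg (linfun (@evaluation t)) == fullv by rewrite memvf.
  by rewrite eqEdim subvf dimvf /dim /= mul1n.
case/memv_imgP => h _; rewrite lfunE => /rowP e.
exists (mpoly_of_dhomog h); first exact: dhomog_is_dhomog.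
by move=> j; have := e j; rewrite !mxE /= eq_sym => <-.
Qed.

End Evaluation.
End Points.

Local Close Scope ring_scope.

Theorem proposition2p2 (k : closedFieldType) (char0 : [pchar k]%R =i pred0)
    (d : nat) (hd : 3 <= d) (s : nat) (hs : s = 'C(d, 2) + 1)
    (X : {fset P2 k}) (hX : chi_gen s X) :
  forall t : nat, t <= d -> H_double_pts X t = 'C(t + 2, 2).
Proof.
case: hX => cardX HX t letd.
case: d hd hs letd => // m m1 hs letd; rewrite ltnS in m1.
have sE : 2 * #|` X| = m * m.+1 + 2.
  rewrite cardX hs; have := mul2_bin2 m.-1.
  by rewrite addn2 prednK ?(ltn_trans _ m1) //; nia.
have Hm1 : H_pts X m.-1 = 'C(m.-1 + 2, 2).
  rewrite HX /H_gen hs; apply/minn_idPr.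
  by rewrite addn2 prednK ?(ltn_trans _ m1) // leq_addr.
have Hm : H_pts X m = #|` X|.
  rewrite HX /H_gen cardX; apply/minn_idPl.
  by have := mul2_bin2 m; move: sE; rewrite cardX; nia.
rewrite /H_double_pts /hilbert dim_dhomog3 setdim_eq0 ?subn0 // => f fD.
have X0 : ('X_ord0 != 0 :> {mpoly k[3]})%R by rewrite -msize_poly_eq0 msizeX.
have fS i := double_point_ideal_singular (fD _ (point_mem i)).
have hF : (mpoly_of_dhomog f * 'X_ord0 ^+ (m.+1 - t))%R \is m.+1.-homog.
  rewrite -[X in X.-homog](subnKC letd).
  apply: dhomogM; first exact: dhomog_is_dhomog.
  by rewrite -[X in X.-homog]mul1n; apply: dhomogMn; rewrite dhomogX /= mdeg1.
have := no_singular_form char0 m1 _ (fun i => rep_neq0 (point i))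
  (fun g => evaluation_injective Hm1 (g := g)) (evaluation_surjective Hm) hF.
rewrite sE leqnn => /(_ isT) F0; apply: val_inj => /=.
apply: (mulIf (expf_neq0 (m.+1 - t) X0)); rewrite mul0r; apply: F0 => [i|i l].
  by rewrite mevalM (fS i).1 mul0r.
by rewrite mderivM mevalD !mevalM (fS i).1 (fS i).2 !mul0r addr0.
Qed.
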